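(* Let $n\ge1$ and let $\mu\subset\lambda$ be partitions with at most $n$ parts (stable dominant weights). Then the map $$\mathrm{domres}(\lambda,\mu)\ \longrightarrow\ \mathcal{DR}(\lambda,\mu),\qquad T\mapsto w(T),$$ is a bijection between the tableaux in $\mathrm{domres}(\lambda,\mu)$ and the lattice points of the convex polytope $\mathcal{DR}(\lambda,\mu)\subset\mathbb{R}^{n(n+1)/2}$.
   Context: Let $\mathcal{C}_n=\{1<\dots<n<\bar n<\dots<\bar1\}$. Semistandard tableaux have strictly increasing columns and weakly increasing rows. The word $W(T)$ of a tableau is read column by column from the rightmost column to the leftmost, each column from top to bottom. The weight of a word $w_1\cdots w_r$ is $\sum_i\varepsilon_{w_i}\in\mathbb{Z}^n$, with $\varepsilon_1,\dots,\varepsilon_n$ the standard basis and $\varepsilon_{\bar i}=-\varepsilon_i$; a weight $(c_1,\dots,c_n)$ is dominant if $c_1\ge\dots\ge c_n\ge0$ (then identified with a partition). $\mathrm{domres}(\lambda,\mu)$ is the set of semistandard tableaux $T$ of shape $\lambda$ with entries in $\mathcal{C}_n$ such that $W(T)$ has weight $\mu$ and every prefix of $W(T)$ has dominant weight. For a tableau $T$ with entries in $\mathcal{C}_n$ and at most $n$ rows, $(i,j)$ denotes the number of letters $i\in\mathcal{C}_n$ in row $j\in\{1,\dots,n\}$. For $T\in\mathrm{domres}(\lambda,\mu)$ with $\lambda$ stable, $(i,j)=0$ unless $i=j$ or $i=\bar k$ with $1\le k\le j-1$. So $T$ is encoded by the vector $w(T)$ of the $n(n+1)/2$ numbers $(j,j)$,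 $1\le j\le n$, and $(\bar k,j)$, $1\le k<j\le n$. $\mathcal{DR}(\lambda,\mu)$ is the set of real vectors with coordinates $(j,j)\ge0$ ($1\le j\le n$) and $(\bar k,j)\ge0$ ($1\le k<j\le n$), all other $(c,j)$ being set to $0$, satisfying: (shape) $\sum_{c\in\mathcal{C}_n}(c,j)=\lambda_j$ for $1\le j\le n$; (weight) $(i,i)-\sum_{k=i+1}^{n}(\bar i,k)=\mu_i$ for $1\le i\le n$; (semistandardness) $\sum_{a\in\mathcal{C}_n,\,a\le c}(a,j+1)\le\sum_{a\in\mathcal{C}_n,\,a<c}(a,j)$ for all $c\in\mathcal{C}_n$ and $1\le j\le n-1$; (cancellation) $(i,i)\ge(\bar i,k)+\sum_{a\in\mathcal{C}_n,\,a<\bar i}(a,k)$ for $1\le i<k\le n$; (dominance) $(i,i)-(i+1,i+1)-\sum_{k=i}^{l}\big[(\bar i,k)-(\overline{i+1},k-1)\big]\ge0$ for $1\le i\le n-1$ and $i\le l\le n$. *)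

(* Defs.v *)
From HB Require Import structures.
From mathcomp Require Import all_boot all_order all_algebra.
From mathcomp Require Import boolp classical_sets functions reals.

Set Implicit Arguments.
Unset Strict Implicit.
Unset Printing Implicit Defensive.

Import Order.TTheory GRing.Theory Num.Theory.

(* Indices are shifted by one: i : 'I_n stands for the letter, row or weight
   component usually numbered i + 1. *)

(* inl i is the letter i and inr i is the barred letter \bar i. *)
Definition letter (n : nat) : finType := ('I_n + 'I_n)%type.

Definition unb (n : nat) (i : 'I_n) : letter n := inl i.
Definition bar (n : nat) (i : 'I_n) : letter n := inr i.

(* Position of a letter in 1 < ... < n < \bar n < ... < \bar 1. *)
Definition lrank (n : nat) (c : letter n) : nat :=
  match c with inl i => i | inr i => n + rev_ord i end.

Definition lle (n : nat) : rel (letter n) := fun a b => lrank a <= lrank b.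
Definition llt (n : nat) : rel (letter n) := fun a b => lrank a < lrank b.

Definition is_partition (n : nat) (lam : n.-tuple nat) : bool := sorted geq lam.

Definition included (n : nat) (mu lam : n.-tuple nat) : Prop :=
  forall i : 'I_n, tnth mu i <= tnth lam i.

(* A filling is the list of its rows, from top to bottom; rows may be empty. *)
Definition filling (n : nat) : Type := seq (seq (letter n)).

(* The entries at position c of the rows that are long enough. *)
Definition column (n : nat) (T : filling n) (c : nat) : seq (letter n) :=
  pmap (fun r => onth r c) T.

(* Only meant for fillings whose shape is a partition, where the boxes of a
   column lie in consecutive rows. *)
Definition semistandard (n : nat) (T : filling n) : Prop :=
  (forall r, r \in T -> sorted (@lle n) r) /\
  (forall c : nat, sorted (@llt n) (column T c)).

(* For a partition shape, the number of columns is the length of row one. *)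
Definition word (n : nat) (T : filling n) : seq (letter n) :=
  flatten [seq column T c | c <- rev (iota 0 (size (head [::] T)))].

Local Open Scope ring_scope.

Definition eps (n : nat) (c : letter n) : 'rV[int]_n :=
  match c with inl i => delta_mx 0 i | inr i => - delta_mx 0 i end.

Definition weight (n : nat) (s : seq (letter n)) : 'rV[int]_n :=
  \sum_(c <- s) eps c.

Definition dominant (n : nat) (v : 'rV[int]_n) : Prop :=
  (forall i j : 'I_n, (i <= j)%N -> v 0 j <= v 0 i) /\
  (forall i : 'I_n, 0 <= v 0 i).

Definition domres (n : nat) (lam mu : n.-tuple nat) : set (filling n) :=
  [set T | [/\ shape T = lam,
               semistandard T,
               weight (word T) = \row_i (tnth mu i)%:Z &
               forall s, prefix s (word T) -> dominant (weight s)]]%classic.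

(* The coordinates (j, j), and (\bar k, j) with k < j. *)
Definition is_coord (n : nat) (p : letter n * 'I_n) : bool :=
  match p.1 with inl i => i == p.2 | inr k => (k < p.2)%N end.

Definition coord (n : nat) : finType := {p : letter n * 'I_n | is_coord p}.

Lemma card_coord (n : nat) : #|coord n| = ((n * n.+1) %/ 2)%N.
Proof.
rewrite card_sig -sum1_card (eq_bigl (fun p => is_coord (p.1, p.2))); last first.
  by case.
rewrite -(pair_big_dep xpredT (fun a b => is_coord (a, b)) (fun _ _ => 1%N)) /=.
rewrite (exchange_big_dep xpredT) //= (eq_bigr (fun j : 'I_n => j.+1)).
  rewrite divn2 mulnC -[n in RHS]/(n.+1.-1) -bin2 -bin2_sum.
  by rewrite big_mkord big_ord_recl.
move=> j _; rewrite sum1_card.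
rewrite (_ : #|_| = #|[pred c | is_coord (c, j)]|); last exact: eq_card.
rewrite -sum1_card big_sumType /= /is_coord /= big_pred1_eq add1n; congr _.+1.
rewrite -(big_ord_widen n (fun=> 1%N)) ?(ltnW (ltn_ord j)) //.
by rewrite sum_nat_const card_ord muln1.
Qed.

(* The number of letters c in row j. *)
Definition mult (n : nat) (T : filling n) (c : letter n) (j : 'I_n) : nat :=
  count_mem c (nth [::] T j).

Definition wvec (R : realType) (n : nat) (T : filling n) : {ffun coord n -> R} :=
  [ffun p => (mult T (sval p).1 (sval p).2)%:R].

Arguments wvec R {n} T.

(* The value (c, j), extended by 0 when it is not a coordinate. *)
Definition cell (R : realType) (n : nat) (x : {ffun coord n -> R})
    (c : letter n) (j : 'I_n) : R :=
  oapp x 0 (insub (c, j)).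

(* The value (c, j - 1), which is 0 when j is the first row. *)
Definition cell_above (R : realType) (n : nat) (x : {ffun coord n -> R})
    (c : letter n) (j : 'I_n) : R :=
  \sum_(j' < n | j'.+1 == j) cell x c j'.

Definition shape_cond (R : realType) (n : nat) (lam : n.-tuple nat)
    (x : {ffun coord n -> R}) : Prop :=
  forall j : 'I_n, \sum_(c : letter n) cell x c j = (tnth lam j)%:R.

Definition weight_cond (R : realType) (n : nat) (mu : n.-tuple nat)
    (x : {ffun coord n -> R}) : Prop :=
  forall i : 'I_n,
    cell x (unb i) i - \sum_(k < n | (i < k)%N) cell x (bar i) k
    = (tnth mu i)%:R.

Definition semistandard_cond (R : realType) (n : nat)
    (x : {ffun coord n -> R}) : Prop :=
  forall (c : letter n) (j j' : 'I_n), j' = j.+1 :> nat ->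
    \sum_(a | lle a c) cell x a j' <= \sum_(a | llt a c) cell x a j.

Definition cancellation_cond (R : realType) (n : nat)
    (x : {ffun coord n -> R}) : Prop :=
  forall i k : 'I_n, (i < k)%N ->
    cell x (unb i) i
    >= cell x (bar i) k + \sum_(a | llt a (bar i)) cell x a k.

Definition dominance_cond (R : realType) (n : nat)
    (x : {ffun coord n -> R}) : Prop :=
  forall i i' l : 'I_n, i' = i.+1 :> nat -> (i <= l)%N ->
    cell x (unb i) i - cell x (unb i') i'
    - \sum_(k < n | (i <= k <= l)%N)
        (cell x (bar i) k - cell_above x (bar i') k) >= 0.

Definition DR (R : realType) (n : nat) (lam mu : n.-tuple nat) :
    set {ffun coord n -> R} :=
  [set x : {ffun coord n -> R} |
    [/\ (forall p : coord n, 0 <= x p),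
        shape_cond lam x & weight_cond mu x] /\
    [/\ semistandard_cond x,
        cancellation_cond x & dominance_cond x]]%classic.

Arguments DR R {n} lam mu.

Definition lattice_points (R : realType) (I : finType) (S : set {ffun I -> R}) :
    set {ffun I -> R} :=
  [set x : {ffun I -> R} | S x /\ forall p : I, x p \is a Num.int]%classic.

(* A bounded intersection of finitely many closed half-spaces. *)
Definition is_polytope (R : realType) (I : finType) (S : set {ffun I -> R}) :
    Prop :=
  (exists (m : nat) (a : 'I_m -> {ffun I -> R}) (b : 'I_m -> R),
     S = [set x : {ffun I -> R} |
            forall k : 'I_m, \sum_(p : I) a k p * x p <= b k]%classic) /\
  (exists M : R, forall x, S x -> forall p : I, `|x p| <= M).

(* Main.v *)
Require Import Defs.
From mathcomp Require Import all_boot all_order all_algebra.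
From mathcomp Require Import boolp classical_sets functions reals.
From mathcomp Require Import zify.

Set Implicit Arguments.
Unset Strict Implicit.
Unset Printing Implicit Defensive.

Import Order.TTheory GRing.Theory Num.Theory.

(** A prefix of the word of T contains in row k exactly the boxes in columns
>= c_k, where c_k = c in the rows before some row r and c_k = c + 1 from row r
on. Hence T is a highest weight tableau if and only if all these regions have
dominant weight [yamanouchiP].

Dominance forces the letters of row k to be k or barred letters \bar j with
j < k [on_coord_of_yamanouchi]: read the boxes in the order of the word, and
consider the first letter that violates this. It is larger than k, so no
letter k stands to its right in row k; by the rules for columns, no unbarred
letter i >= k has been read at all. Hence reading the new letter makes component
i exceed component i - 1 if it is i, and makes component i negative if it is
\bar i.

For a tableau with this support, the difference of the components i and i + 1
of the weight of a region depends on four kinds of blocks of letters: i in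
row i, i + 1 in row i + 1, and the blocks of \bar i and of \overline{i+1} in
the rows k >= i. In row k these last two are adjacent, \overline{i+1} in the
columns from d_k to a_k - 1 and \bar i in those from a_k to b_k - 1, and
column strictness says exactly that they interlace:
b_{k+1} <= a_k and a_{k+1} <= d_k. The dominance inequalities of the polytope
say that this difference is nonnegative for the full rows up to row l, less
the letters \overline{i+1} of row l. Elementary estimates on interlacing
sequences pass from these to all regions [region_ineq_of_row_ineq]. Conversely,
the inequality at l follows from the region that ends with the box of row l in
column a_l, the leftmost \bar i of that row if there is one
[row_ineq_of_region_ineq]. So, for semistandard
tableaux with the right support, being highest weight is equivalent to the
dominance inequalities [yamanouchi_dominance_ineqs].

The other conditions of the polytope are the shape, the weight, column strictness
(column strictness of two sorted rows is a comparison of letter counts,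
[columns_strictP]) and cancellation, which follows from interlacing. A tableau
with sorted rows is determined by its letter counts, so the encoding is injective;
sorting the rows prescribed by a lattice point gives surjectivity.

The polytope itself is bounded because the coordinates in row j are nonnegative
with sum lambda_j, and it is a finite intersection of half-spaces because all
conditions are weak inequalities or equations between affine functions. *)

(** * Finite intersections of half-spaces *)

Section Polyhedra.
Local Open Scope ring_scope.
Local Open Scope classical_set_scope.
Variables (R : realType) (I : finType).
Implicit Types (f g : {ffun I -> R} -> R) (S : set {ffun I -> R}).

Definition linear_form f : Prop :=
  exists a : {ffun I -> R}, forall x, f x = \sum_p a p * x p.

Lemma linear_form_coord p : linear_form (fun x => x p).
Proof.
exists [ffun q => (q == p)%:R] => x.
rewrite (bigD1 p) //= ffunE eqxx mul1r big1 ?addr0 // => q ne_qp.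
by rewrite ffunE (negPf ne_qp) mul0r.
Qed.

Lemma linear_form0 : linear_form (fun=> 0).
Proof. by exists [ffun=> 0] => x; rewrite big1 // => p _; rewrite ffunE mul0r. Qed.

Lemma linear_formD f g :
  linear_form f -> linear_form g -> linear_form (fun x => f x + g x).
Proof.
move=> [a fa] [b gb]; exists [ffun p => a p + b p] => x.
by rewrite fa gb -big_split; apply: eq_bigr => p _; rewrite ffunE mulrDl.
Qed.

Lemma linear_formN f : linear_form f -> linear_form (fun x => - f x).
Proof.
move=> [a fa]; exists [ffun p => - a p] => x.
by rewrite fa -sumrN; apply: eq_bigr => p _; rewrite ffunE mulNr.
Qed.

Lemma linear_formB f g :
  linear_form f -> linear_form g -> linear_form (fun x => f x - g x).
Proof. by move=> lf lg; apply/linear_formD/linear_formN. Qed.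

Lemma linear_form_sum (J : finType) (P : pred J) (F : J -> {ffun I -> R} -> R) :
  (forall j, linear_form (F j)) -> linear_form (fun x => \sum_(j | P j) F j x).
Proof.
move=> /choice[a Fa]; exists [ffun p => \sum_(j | P j) a j p] => x.
under eq_bigr do rewrite Fa.
by rewrite exchange_big; apply: eq_bigr => p _; rewrite ffunE mulr_suml.
Qed.

(** A pair (a, b) stands for the half-space a . x <= b; a list of such pairs makes
    intersections concatenations. *)
Definition halfspaces (s : seq ({ffun I -> R} * R)) : set {ffun I -> R} :=
  [set x | forall h, h \in s -> \sum_p h.1 p * x p <= h.2].

Definition polyhedron S : Prop := exists s, S = halfspaces s.

Lemma polyhedron_le f (b : R) : linear_form f -> polyhedron [set x | f x <= b].
Proof.
move=> [a fa]; exists [:: (a, b)]; apply/seteqP; split=> x /=.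
  by rewrite fa => ? h; rewrite inE => /eqP ->.
by move=> /(_ (a, b)); rewrite fa; apply; rewrite inE.
Qed.

Lemma polyhedron_le_forms f g : linear_form f -> linear_form g ->
  polyhedron [set x | f x <= g x].
Proof.
move=> lf lg; have := polyhedron_le 0 (linear_formB lf lg).
by congr polyhedron; apply/seteqP; split=> x /=; rewrite subr_le0.
Qed.

Lemma polyhedron_forall (K : finType) (S : K -> set {ffun I -> R}) :
  (forall k, polyhedron (S k)) -> polyhedron [set x | forall k, S k x].
Proof.
move=> /choice[s Ss]; exists (flatten [seq s k | k <- enum K]).
apply/seteqP; split=> x /= H.
  by move=> h /flattenP[_ /mapP[k _ ->] hk]; have := H k; rewrite Ss; apply.
move=> k; rewrite Ss => h hk; apply: H; apply/flattenP; exists (s k) => //.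
by rewrite map_f ?mem_enum.
Qed.

Lemma polyhedron_imply (P : Prop) S : (P -> polyhedron S) ->
  polyhedron [set x | P -> S x].
Proof.
move=> polS; have [p|np] := pselect P.
  rewrite (_ : [set x | _] = S); first exact: polS.
  by apply/seteqP; split=> x //= /(_ p).
by exists [::]; apply/seteqP; split=> x /= _ // /np.
Qed.

Lemma polyhedronI S S' : polyhedron S -> polyhedron S' -> polyhedron (S `&` S').
Proof.
move=> polS polS'.
rewrite (_ : S `&` S' = [set x | forall b : bool, (if b then S else S') x]).
  by apply: polyhedron_forall => -[].
apply/seteqP; split=> x; first by move=> [Sx S'x] [].
by move=> H; split; [apply: (H true)|apply: (H false)].
Qed.

Lemma polyhedron_eq f (b : R) : linear_form f -> polyhedron [set x | f x = b].
Proof.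
move=> lf; rewrite (_ : [set x | _] =
    [set x | f x <= b] `&` [set x | - f x <= - b]).
  by apply: polyhedronI; apply: polyhedron_le => //; exact: linear_formN.
apply/seteqP; split=> x /=; first by move=> ->.
by move=> [le_fb]; rewrite lerN2 => le_bf; apply/eqP; rewrite eq_le le_fb.
Qed.
End Polyhedra.

(** * The set DR is a polytope *)

Section Polytope.
Local Open Scope ring_scope.
Local Open Scope classical_set_scope.
Variables (R : realType) (n : nat) (lam mu : n.-tuple nat).

Local Notation V := {ffun Defs.coord n -> R}.

Lemma linear_form_cell c j : linear_form (fun x : V => cell x c j).
Proof.
rewrite /cell; case: insubP => [u _ _|_] /=; first exact: linear_form_coord.
exact: linear_form0.
Qed.

Lemma linear_form_cell_above c j :
  linear_form (fun x : V => cell_above x c j).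
Proof. by apply: linear_form_sum => j'; apply: linear_form_cell. Qed.

Lemma polyhedron_DR : polyhedron (DR R lam mu).
Proof.
have cellP := linear_form_cell; have cell_aboveP := linear_form_cell_above.
have sumP (J : finType) (P : pred J) F := @linear_form_sum R (Defs.coord n) J P F.
rewrite (_ : DR R lam mu = [set x : V | forall p, 0 <= x p] `&`
    ([set x : V | shape_cond lam x] `&` ([set x : V | weight_cond mu x] `&`
    ([set x : V | semistandard_cond x] `&`
    ([set x : V | cancellation_cond x] `&` [set x : V | dominance_cond x])))));
  last first.
  apply/seteqP; split=> x; first by move=> [[? ? ?] [? ? ?]].
  by move=> [? [? [? [? [? ?]]]]].
do 5?apply: polyhedronI.
- apply: polyhedron_forall => p; apply: polyhedron_le_forms.
    exact: linear_form0.
  exact: linear_form_coord.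
- apply: polyhedron_forall => j; apply: polyhedron_eq; exact: sumP.
- apply: polyhedron_forall => i; apply: polyhedron_eq.
  by apply: linear_formB => //; apply: sumP.
- do 3!apply: polyhedron_forall => ?; apply: polyhedron_imply => _.
  by apply: polyhedron_le_forms; apply: sumP.
- do 2!apply: polyhedron_forall => ?; apply: polyhedron_imply => _.
  by apply: polyhedron_le_forms => //; apply: linear_formD => //; apply: sumP.
- do 3!apply: polyhedron_forall => ?; do 2!apply: polyhedron_imply => _.
  apply: polyhedron_le_forms; first exact: linear_form0.
  apply: linear_formB; first exact: linear_formB.
  by apply: sumP => k; apply: linear_formB.
Qed.

Lemma polytope_DR : is_polytope (DR R lam mu).
Proof.
split.
  have [s ->] := polyhedron_DR.
  exists (size s), (fun k => (tnth (in_tuple s) k).1), (fun k => (tnth (in_tuple s) k).2).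
  apply/seteqP; split=> x /= H; first by move=> k; apply: H; apply: mem_tnth.
  by move=> h /(tnthP (in_tuple s))[k ->]; apply: H.
(* A coordinate in row j is at most lambda_j by the shape condition. *)
exists (\sum_(j < n) (tnth lam j)%:R) => x [[x_ge0 shx _] _] p.
have cell_ge0 c j : 0 <= cell x c j by rewrite /cell; case: insubP => /=.
rewrite ger0_norm //.
have -> : x p = cell x (sval p).1 (sval p).2.
  rewrite /cell; have -> : insub ((sval p).1, (sval p).2) = Some p; last by [].
  by rewrite -surjective_pairing; apply: valK.
apply: (@le_trans _ _ (tnth lam (sval p).2)%:R).
  by rewrite -shx (bigD1 (sval p).1) //= lerDl sumr_ge0.
by rewrite (bigD1 (sval p).2) //= lerDl sumr_ge0.
Qed.
End Polytope.

(** * Columns and prefixes of the word *)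

Section Prefixes.
Variable A : eqType.
Implicit Types (T : seq (seq A)) (s : seq A) (p : pred A).

(** [column T c], over an arbitrary alphabet. *)
Definition boxcol T (c : nat) : seq A := pmap (fun t => onth t c) T.

(** The boxes that have been read just before row r of column c: all columns to
    the right of c, and the rows of column c above row r. *)
Definition region T (c r : nat) : seq A :=
  flatten (mkseq (fun k => drop (c + (r <= k)) (nth [::] T k)) (size T)).

Lemma count_region p T c r :
  count p (region T c r) =
  \sum_(k < size T) count p (drop (c + (r <= k)) (nth [::] T k)).
Proof.
rewrite /region count_flatten sumnE big_map /mkseq big_map.
rewrite -(big_mkord xpredT (fun k => count p (drop (c + (r <= k)) (nth [::] T k)))).
by rewrite /index_iota subn0.
Qed.

Lemma count_drop_onth p s c :
  count p (drop c s) = oapp p false (onth s c) + count p (drop c.+1 s).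
Proof. by elim: s c => [|x s IHs] [|c] //=; rewrite ?drop0. Qed.

Lemma count_column p T c r :
  count p (pmap (fun t => onth t c) (take r T)) + \sum_(t <- T) count p (drop c.+1 t)
  = count p (region T c r).
Proof.
rewrite count_region; elim: T r => [|t T IHT] r.
  by rewrite big_nil big_ord0.
rewrite big_cons.
have -> : \sum_(k < size (t :: T)) count p (drop (c + (r <= k)) (nth [::] (t :: T) k))
    = count p (drop (c + (r <= 0)) t)
      + \sum_(k < size T) count p (drop (c + (r <= k.+1)) (nth [::] T k)).
  by rewrite big_ord_recl.
case: r => [|r].
  rewrite [c + (0 <= 0)]addn1 take0 add0n; congr (_ + _).
  have := IHT 0; rewrite take0 add0n.
  by move=> ->; apply: eq_bigr => k _; rewrite addn1.
rewrite /= addn0 [in RHS]count_drop_onth; under [in RHS]eq_bigr => k _ do rewrite ltnS.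
rewrite -IHT.
by case: (onth t c) => [x|] /=; lia.
Qed.

Lemma count_columns p T c m : (forall t, t \in T -> size t <= c + m) ->
  count p (flatten [seq boxcol T c' | c' <- rev (iota c m)]) =
  \sum_(t <- T) count p (drop c t).
Proof.
elim: m c => [|m IHm] c szT.
  rewrite /= big_seq big1 // => t /szT; rewrite addn0 => le_tc.
  by rewrite drop_oversize.
rewrite /= rev_cons map_rcons flatten_rcons count_cat IHm; last first.
  by move=> t /szT; rewrite addSnnS.
rewrite addnC /boxcol.
have := count_column p T c (size T); rewrite take_size => ->.
rewrite count_region (big_nth [::]) big_mkord; apply: eq_bigr => k _.
by rewrite leqNgt ltn_ord addn0.
Qed.

(** Rows that do not reach column c leave no trace in it; for a partition shape
    they come after all others, so neighbours in the column lie in consecutive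
    rows. *)
Lemma sorted_boxcol (e : rel A) T c : sorted geq (shape T) ->
  sorted e (boxcol T c) <->
  (forall k x y, onth (nth [::] T k) c = Some x ->
                 onth (nth [::] T k.+1) c = Some y -> e x y).
Proof.
elim: T => [|t T IHT] part.
  by split=> // _ k x y; rewrite !nth_nil onth0n.
have {IHT} := IHT (path_sorted part); rewrite /boxcol /=.
case: T part => [|t' T] part IHT.
  split=> [_ k x y _ |_]; first by rewrite nth_nil onth0n.
  by case: (onth t c).
have szt : size t' <= size t by move: part => /andP[].
case tc: (onth t c) => [x|] /=; last first.
  have tc' : onth t' c = None.
    by apply: onth_default; apply: leq_trans szt _; rewrite -onthNE tc.
  move: IHT; rewrite /= !tc' /= => IHT; split=> [/IHT IH [|k] y z /=|H].
  - by rewrite tc.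
  - exact: IH.
  - by apply/IHT => k y z; apply: (H k.+1).
case tc': (onth t' c) => [x'|]; move: IHT; rewrite /= !tc' /= => IHT.
  split=> [/andP[xx' /IHT IH] [|k] y z /=|H].
  - by rewrite tc tc' => -[<-] [<-].
  - exact: IH.
  - by apply/andP; split; [apply: (H 0)|apply/IHT => k y z; apply: (H k.+1)].
suff: pmap (fun t0 => onth t0 c) T = [::].
  move=> Z; rewrite !Z in IHT *; split=> // _ [|k] y z /=; first by rewrite tc'.
  exact: IHT.1.
suff: all (fun u => size u <= size t') T.
  elim: T {part IHT} => //= u T IHT /andP[le_u /IHT ->].
  rewrite onth_default //=; apply: leq_trans le_u _.
  by rewrite -onthNE tc'.
have := order_path_min (rev_trans leq_trans) (path_sorted part).
by rewrite all_map.
Qed.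

Lemma take_pmap (B C : Type) (f : B -> option C) (u : seq B) (k : nat) :
  exists r, take k (pmap f u) = pmap f (take r u).
Proof.
elim: u k => [|x u IHu] k /=; first by exists 0.
case fx: (f x) => [y|] /=.
  case: k => [|k]; first by exists 0.
  by have [r e] := IHu k; exists r.+1; rewrite /= fx e.
by have [r ->] := IHu k; exists r.+1; rewrite /= fx.
Qed.

Lemma take_flatten (B : Type) (ss : seq (seq B)) (k : nat) :
  exists j l, take k (flatten ss) = flatten (take j ss) ++ take l (nth [::] ss j).
Proof.
elim: ss k => [|s ss IHss] k; first by exists 0, 0.
rewrite /= take_cat; case: ltnP => [lt_ks|le_sk]; first by exists 0, k.
have [j [l ->]] := IHss (k - size s).
by exists j.+1, l; rewrite /= catA.
Qed.

Variable T : seq (seq A).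
Hypothesis T_part : sorted geq (shape T).
Let M := size (head [::] T).
Let word := flatten [seq boxcol T c | c <- rev (iota 0 M)].

Lemma size_row_head t : t \in T -> size t <= M.
Proof.
move=> tT; rewrite /M; case: T T_part tT => [|t0 T'] //= part.
rewrite inE => /predU1P[-> //|tT'].
have := order_path_min (rev_trans leq_trans) part => /allP; apply.
exact: map_f.
Qed.

Lemma size_row_nth k : size (nth [::] T k) <= M.
Proof.
case: (ltnP k (size T)) => [lt_k|le_k]; last by rewrite nth_default.
by apply/size_row_head/mem_nth.
Qed.

Lemma size_rowS k : size (nth [::] T k.+1) <= size (nth [::] T k).
Proof.
case: (ltnP k.+1 (size T)) => [lt_k|le_k]; last by rewrite nth_default.
have := T_part => /(sortedP 0) /(_ k); rewrite size_map => /(_ lt_k).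
by rewrite !(nth_map [::]) // ltnW.
Qed.

(** Only up to order: the word goes through a region column by column, while
    the region lists its boxes row by row. *)
Lemma prefix_of_region c r :
  exists2 s, prefix s word & perm_eq s (region T c r).
Proof.
case: (ltnP c M) => [lt_cM|le_Mc]; last first.
  exists [::]; first by rewrite prefix0s.
  rewrite (_ : region T c r = [::]) // /region; apply/nilP; rewrite /nilp size_flatten.
  rewrite sumnE /shape big_map big_map big_seq big1 // => k _.
  by rewrite size_drop; have := size_row_nth k; lia.
exists (flatten [seq boxcol T c' | c' <- rev (iota c.+1 (M - c.+1))] ++
        pmap (fun t => onth t c) (take r T)).
  rewrite /word (_ : M = c + (M - c.+1).+1); last lia.
  rewrite iotaD rev_cat add0n map_cat flatten_cat /= rev_cons map_rcons flatten_rcons.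
  rewrite (_ : c + (M - c.+1).+1 - c.+1 = M - c.+1); last lia.
  rewrite /boxcol -{4}(cat_take_drop r T) pmap_cat -!catA catA.
  exact: prefix_prefix.
apply/permP => p; rewrite count_cat count_columns -?count_column 1?addnC //.
by move=> t /size_row_head; lia.
Qed.

Lemma region_of_prefix s : prefix s word ->
  exists c r, perm_eq s (region T c r).
Proof.
rewrite prefixE => /eqP <-; rewrite /word.
have [j [l ->]] :=
    take_flatten [seq boxcol T c | c <- rev (iota 0 M)] (size s).
have [le_Mj|lt_jM] := leqP M j.
  (* All columns have been read: the prefix is the whole word. *)
  exists 0, (size T); apply/permP => p.
  rewrite take_oversize ?nth_default ?size_map ?size_rev ?size_iota // cats0.
  rewrite count_columns; last exact: size_row_head.
  rewrite count_region (big_nth [::]) big_mkord; apply: eq_bigr => k _.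
  by rewrite leqNgt ltn_ord.
rewrite -map_take (nth_map 0) ?size_rev ?size_iota // nth_rev ?size_iota //.
rewrite nth_iota; last lia.
have [r ->] := take_pmap (fun t => onth t (0 + (M - j.+1))) T l.
exists (M - j.+1), r; apply/permP => p.
rewrite (_ : take j _ = rev (iota (M - j.+1).+1 j)); last first.
  rewrite take_rev size_iota drop_iota; congr (rev (iota _ _)); lia.
rewrite count_cat count_columns -?count_column 1?addnC ?add0n //.
by move=> t /size_row_head; lia.
Qed.
End Prefixes.

Section RegionFacts.
Variable A : eqType.
Implicit Types (T : seq (seq A)) (p : pred A).

Lemma count_regionS p T c r : r < size T ->
  count p (region T c r.+1) =
  count p (region T c r) + oapp p false (onth (nth [::] T r) c).
Proof.
move=> lt_r; rewrite -!count_column (take_nth [::]) // -cats1 pmap_cat count_cat /=.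
by case: onth => [x|] /=; lia.
Qed.

Lemma mem_region T c r x : x \in region T c r ->
  exists k c', c + (r <= k) <= c' /\ onth (nth [::] T k) c' = Some x.
Proof.
move=> /flattenP[s /mapP[k _ ->]] /onthP[j]; rewrite onthE map_drop nth_drop -onthE => xj.
by exists k, (c + (r <= k) + j); rewrite leq_addr.
Qed.
End RegionFacts.

(** * Counting letters in sorted rows *)

Lemma lrank_inj n : injective (@lrank n).
Proof.
move=> [i|i] [j|j] /= e; have := ltn_ord i; have := ltn_ord j; move=> *; try lia.
  by congr (inl _); apply: val_inj.
by congr (inr _); apply: val_inj => /=; lia.
Qed.

Section SortedRows.
Variable n : nat.
Implicit Types (s t : seq (letter n)) (x y : letter n) (p : pred (letter n)).

Lemma lle_trans : transitive (@lle n).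
Proof. by move=> y x z; apply: leq_trans. Qed.

Lemma lle_total : total (@lle n).
Proof. by move=> x y; apply: leq_total. Qed.

Lemma lle_anti : antisymmetric (@lle n).
Proof. by move=> x y; rewrite /lle -eqn_leq => /eqP/lrank_inj. Qed.

Definition downclosed p := forall x y, lle x y -> p y -> p x.

Lemma downclosed_le x : downclosed (@lle n ^~ x).
Proof. by move=> y z yz /(lle_trans yz). Qed.

Lemma downclosed_lt x : downclosed (@llt n ^~ x).
Proof. by move=> y z; rewrite /lle /llt; apply: leq_ltn_trans. Qed.

Lemma onth_sorted s : sorted (@lle n) s -> forall i j x y, i <= j ->
  onth s i = Some x -> onth s j = Some y -> lle x y.
Proof.
move=> s_sorted i j x y le_ij si sj.
have lt_js : j < size s by rewrite -onthTE sj.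
have lt_is := leq_ltn_trans le_ij lt_js.
rewrite -(onth_nth x _ _ _ si) -(onth_nth x _ _ _ sj).
by apply: (sorted_leq_nth lle_trans (fun z => leqnn (lrank z))); rewrite ?inE.
Qed.

(** In a sorted row the letters satisfying a downward closed predicate form an
    initial segment. *)
Lemma ltn_count_sorted p s c : sorted (@lle n) s -> downclosed p ->
  (c < count p s) = oapp p false (onth s c).
Proof.
move=> s_sorted dp; elim: s s_sorted c => [|x s IHs] xs_sorted c.
  by rewrite onth0n.
rewrite /=; case px: (p x).
  by case: c => [|c] //; rewrite -IHs ?(path_sorted xs_sorted).
have s0 y : y \in s -> p y = false.
  move=> ys; apply: contraFF px; apply: dp.
  exact: (allP (order_path_min lle_trans xs_sorted)).
rewrite (eq_in_count (a2 := pred0)) // count_pred0.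
case: c => [|c] /=; first by rewrite px.
by case sc: (onth s c) => [y|] //=; rewrite s0 //; apply/onthP; exists c.
Qed.

Lemma count_drop_sorted p s c : sorted (@lle n) s -> downclosed p ->
  count p (drop c s) = count p s - c.
Proof.
move=> s_sorted dp; elim: c => [|c IHc]; first by rewrite drop0 subn0.
have := count_drop_onth p s c; rewrite IHc.
have := ltn_count_sorted c s_sorted dp.
by case: (onth s c) => [x|] /=; lia.
Qed.

Lemma count_mem_letter s x :
  count_mem x s + count (@llt n ^~ x) s = count (@lle n ^~ x) s.
Proof.
elim: s => //= y s <-; rewrite addnACA; congr (_ + _).
rewrite /lle /llt (leq_eqVlt (lrank y)) (inj_eq (@lrank_inj n)).
by case: (eqVneq y x) => [->|_]; rewrite ?ltnn.
Qed.

(** The letters x of a sorted row occupy an interval of columns, from the number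
    of smaller letters to the number of letters at most x. *)
Lemma count_mem_drop s x c : sorted (@lle n) s ->
  count_mem x (drop c s) =
  count (@lle n ^~ x) s - maxn (count (@llt n ^~ x) s) c.
Proof.
move=> s_sorted; have := count_mem_letter (drop c s) x.
rewrite (count_drop_sorted _ s_sorted (@downclosed_le x)).
rewrite (count_drop_sorted _ s_sorted (@downclosed_lt x)).
by have := count_mem_letter s x; lia.
Qed.

(** If the count inequality failed at x, the first column c whose upper entry is
    not < x would have a lower entry <= x. Conversely, the lower entry y of
    column c is among the first letters <= y of its row, hence c is among the
    columns whose upper entry is < y. *)
Lemma columns_strictP s t : sorted (@lle n) s -> sorted (@lle n) t ->
    size t <= size s ->
  (forall c x y, onth s c = Some x -> onth t c = Some y -> llt x y) <->
  (forall x, count (@lle n ^~ x) t <= count (@llt n ^~ x) s).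
Proof.
move=> s_sorted t_sorted le_ts; split=> [strict x|cnt c x y sc tc].
  rewrite leqNgt (ltn_count_sorted _ t_sorted) //; last exact: downclosed_le.
  case tc: (onth t _) => [y|] //=; apply/negP => yx.
  have: count (@llt n ^~ x) s < size s.
    by apply: leq_trans le_ts; rewrite -onthTE tc.
  rewrite -onthTE; case sc: (onth s _) => [z|] // _.
  have zx : llt z x by apply: leq_trans yx; apply: strict sc tc.
  have := ltn_count_sorted (count (@llt n ^~ x) s) s_sorted (@downclosed_lt x).
  by rewrite sc /= zx ltnn.
have := ltn_count_sorted c t_sorted (@downclosed_le y); rewrite tc /=.
rewrite /lle leqnn => /idP lt_c.
have := leq_trans lt_c (cnt y).
by rewrite (ltn_count_sorted _ s_sorted (@downclosed_lt y)) sc.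
Qed.
End SortedRows.

Lemma semistandardP n (T : filling n) : sorted geq (shape T) ->
  semistandard T <->
  (forall t, t \in T -> sorted (@lle n) t) /\
  (forall k x, count (@lle n ^~ x) (nth [::] T k.+1) <=
               count (@llt n ^~ x) (nth [::] T k)).
Proof.
move=> part.
have sorted_nth k : (forall t, t \in T -> sorted (@lle n) t) ->
    sorted (@lle n) (nth [::] T k).
  move=> rows; case: (ltnP k (size T)) => lt_k; last by rewrite nth_default.
  exact/rows/mem_nth.
split=> -[rows cols]; split=> //.
  move=> k; apply/(columns_strictP (sorted_nth _ rows) (sorted_nth _ rows)).
    exact: size_rowS.
  by move=> c; have /(sorted_boxcol (@llt n) c part) := cols c; apply.
move=> c; apply/(sorted_boxcol (@llt n) c part) => k.
by move: c; apply/(columns_strictP (sorted_nth _ rows) (sorted_nth _ rows));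
  [exact: size_rowS|exact: cols].
Qed.

(** Semistandard tableaux with [n] possibly empty rows; the last clause is
    column strictness, by [columns_strictP]. *)
Definition young_tableau n (T : filling n) : Prop :=
  [/\ size T = n, sorted geq (shape T),
      forall t, t \in T -> sorted (@lle n) t &
      forall k x, count (@lle n ^~ x) (nth [::] T k.+1) <=
                  count (@llt n ^~ x) (nth [::] T k)].

(** * Dominance of a word in terms of letter counts *)

Lemma weightE n (s : seq (letter n)) (i : 'I_n) :
  (weight s 0 i = (count_mem (unb i) s)%:Z - (count_mem (bar i) s)%:Z)%R.
Proof.
rewrite /weight; elim: s => [|x s IHs]; first by rewrite big_nil mxE.
rewrite big_cons mxE {}IHs /=.
case: x => j /=; rewrite !mxE eqxx /= /unb /bar.
  by rewrite -[inl j == inl i]/(j == i) (eq_sym i); case: (j == i) => /=; lia.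
by rewrite -[inr j == inr i]/(j == i) (eq_sym i); case: (j == i) => /=; lia.
Qed.

Lemma dominantP n (s : seq (letter n)) :
  dominant (weight s) <->
  (forall i j : 'I_n, i <= j ->
     count_mem (unb j) s + count_mem (bar i) s <=
     count_mem (unb i) s + count_mem (bar j) s) /\
  (forall i : 'I_n, count_mem (bar i) s <= count_mem (unb i) s).
Proof.
split=> -[mono pos]; split=> [i j le_ij|i].
- by have := mono i j le_ij; rewrite !weightE; lia.
- by have := pos i; rewrite weightE; lia.
- by have := mono i j le_ij; rewrite !weightE; lia.
- by have := pos i; rewrite weightE; lia.
Qed.

(** The form in which dominance is checked: only simple roots are tested. *)
Lemma dominant_consecutive n (s : seq (letter n)) :
  (forall i i' : 'I_n, i' = i.+1 :> nat ->
     count_mem (unb i') s + count_mem (bar i) s <=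
     count_mem (unb i) s + count_mem (bar i') s) ->
  (forall i : 'I_n, i.+1 = n -> count_mem (bar i) s <= count_mem (unb i) s) ->
  dominant (weight s).
Proof.
move=> step last; apply/dominantP.
have mono (i j : 'I_n) : i <= j ->
     count_mem (unb j) s + count_mem (bar i) s <=
     count_mem (unb i) s + count_mem (bar j) s.
  move: {2}(j - i)%N (leqnn (j - i)) => d; elim: d i => [|d IHd] i le_d le_ij.
    by have -> : i = j by apply: val_inj => /=; lia.
  have [eij|neq_ij] := eqVneq (val i) (val j); first by rewrite (val_inj eij).
  have lt_in : i.+1 < n by have := ltn_ord j; move: neq_ij => /=; lia.
  pose i' := Ordinal lt_in.
  have := IHd i' _ _; have := step i i' erefl; move: neq_ij => /=; lia.
split=> // i.
have lt_n : n.-1 < n by have := ltn_ord i; lia.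
have := mono i (Ordinal lt_n); have := last (Ordinal lt_n) => /=.
by have := ltn_ord i; lia.
Qed.

(** Highest weight, tested on regions instead of prefixes. *)
Definition yamanouchi n (T : filling n) : Prop :=
  forall c r, dominant (weight (region T c r)).

Lemma perm_weight n (s t : seq (letter n)) : perm_eq s t -> weight s = weight t.
Proof. exact: perm_big. Qed.

Lemma yamanouchiP n (T : filling n) : sorted geq (shape T) ->
  (forall s, prefix s (word T) -> dominant (weight s)) <-> yamanouchi T.
Proof.
move=> part; split=> [dom c r|yam s].
  have [s ps /perm_weight <-] := prefix_of_region part c r; exact: dom.
move=> /(region_of_prefix part)[c [r /perm_weight ->]]; exact: yam.
Qed.

(** * Highest weight tableaux are supported on the coordinates *)

Definition supported n (T : filling n) : Prop :=
  forall (k : 'I_n) x, x \in nth [::] T k -> is_coord (x, k).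

Section Support.
Variables (n : nat) (T : filling n).
Hypothesis sst : young_tableau T.
Let size_T : size T = n. Proof. by case: sst. Qed.
Let part : sorted geq (shape T). Proof. by case: sst. Qed.
Let rows t : t \in T -> sorted (@lle n) t. Proof. by case: sst => _ _ + _; apply. Qed.
Let cols k x : count (@lle n ^~ x) (nth [::] T k.+1) <= count (@llt n ^~ x) (nth [::] T k).
Proof. by case: sst. Qed.

Local Notation row := (nth [::] T).

Lemma sorted_row k : sorted (@lle n) (row k).
Proof.
by case: (ltnP k (size T)) => lt_k; [apply/rows/mem_nth|rewrite nth_default].
Qed.

Lemma row_above k c x : onth (row k.+1) c = Some x ->
  exists2 y, onth (row k) c = Some y & llt y x.
Proof.
move=> kx; have lt_c : c < size (row k).
  by apply: leq_trans (size_rowS part k); rewrite -onthTE kx.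
move: lt_c; rewrite -onthTE; case ky: onth => [y|] // _; exists y => //.
have [_ H] := columns_strictP (sorted_row k) (sorted_row k.+1) (size_rowS part k).
by apply: H ky kx => z; exact: cols.
Qed.

Lemma onth_down k k' c x : k <= k' -> onth (row k') c = Some x ->
  exists2 y, onth (row k) c = Some y & lle y x.
Proof.
elim: k' x => [|k' IHk] x; first by rewrite leqn0 => /eqP ->; exists x; rewrite /lle.
rewrite leq_eqVlt => /predU1P[->|le_kk']; first by exists x; rewrite /lle.
move=> /row_above[y /IHk[//|z kz zy] yx]; exists z => //.
by apply: leq_trans zy _; apply: ltnW.
Qed.

Hypothesis yam : yamanouchi T.

(** [is_coord] with rows numbered by nat. *)
Definition on_coord (x : letter n) (k : nat) : bool :=
  match x with inl i => i == k :> nat | inr j => j < k end.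

(** Induction along the word: d bounds the number of columns from c on, and
    within column c the rows are taken from top to bottom. *)
Lemma on_coord_of_yamanouchi c k x : onth (row k) c = Some x -> on_coord x k.
Proof.
move: {2}(size (head [::] T) - c) (leqnn (size (head [::] T) - c)) => d.
elim: d c k x => [|d IHd] c k x le_d.
  move=> kx; have lt_c : c < size (row k) by rewrite -onthTE kx.
  have := leq_trans lt_c (size_row_nth part k).
  by rewrite ltnNge -subn_eq0 -leqn0 le_d.
have {}IHd c' k' y : c < c' -> onth (row k') c' = Some y -> on_coord y k'.
  by move=> lt_c; apply: IHd; lia.
elim/ltn_ind: k x => k IHk x kx.
have lt_k : k < size T.
  by rewrite ltnNge; apply/negP => le_k; rewrite nth_default ?onth0n in kx.
rewrite size_T in lt_k.
pose k0 := Ordinal lt_k.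
(* An unbarred letter i >= k read before box (k, c) lies in row i and in a column
     c' > c; above it, the entry of row k in column c' is at most i, hence it is
     k, although it stands to the right of x > k. *)
have hidden (i : 'I_n) : llt (unb k0) x -> k <= i -> count_mem (unb i) (region T c k) = 0.
  move=> k0x le_ki; apply/count_memPn/negP => /mem_region[k' [c' [le_c k'i]]].
  have lt_cc' : c < c'.
    case: (leqP k k') le_c => [_|lt_k'k]; first by rewrite addn1.
    rewrite addn0 leq_eqVlt => /predU1P[ecc'|//].
    have := IHk k' lt_k'k (unb i); rewrite ecc' k'i => /(_ erefl) /=; lia.
  have /eqP eik' := IHd c' k' _ lt_cc' k'i.
  have [y ky yi] := @onth_down k k' c' _ ltac:(lia) k'i.
  have xy := onth_sorted (sorted_row k) (ltnW lt_cc') kx ky.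
  have := IHd c' k y lt_cc' ky; move: y ky yi xy => [j|j] ky /= yi xy.
    by move=> /eqP ejk; move: xy k0x; rewrite /lle /llt /= ; lia.
  by move: yi; rewrite /lle /=; have := ltn_ord i; lia.
have domS p : count p (region T c k.+1) = count p (region T c k) + p x.
  by rewrite count_regionS ?size_T // kx.
have [monoS posS] := (dominantP _).1 (yam c k.+1).
have [mono pos] := (dominantP _).1 (yam c k).
case: x kx hidden domS => [i|j] kx hidden domS /=.
  have le_ki : k <= i.
    case: k kx IHk {hidden k0 lt_k domS monoS posS mono pos} => [|k] // kx IHk.
    have [y ky] := row_above kx; have := IHk k (leqnn _) y ky.
    by case: y {ky} => [i'|j'] /=; rewrite /llt /=; have := ltn_ord i; lia.
  (* After reading x = i, component i is at least 1 and component i - 1 is at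
     most 0. *)
  rewrite eqn_leq le_ki andbT leqNgt; apply/negP => lt_ki.
  have k0i : llt (unb k0) (inl i) by [].
  have lt_i : i.-1 < n by have := ltn_ord i; lia.
  pose i' := Ordinal lt_i.
  have := monoS i' i _; rewrite !domS !hidden //= /i' /=; try lia.
  have := pos i; rewrite hidden //.
  rewrite /unb /bar.
  have -> : (inl i == inl i :> letter n) = true by rewrite eqxx.
  have -> : (inl i == inl i' :> letter n) = false by apply/eqP => -[] /(congr1 val) /=; lia.
  by rewrite /= ; lia.
(* After reading x = \bar j, component j is negative. *)
rewrite ltnNge; apply/negP => le_kj.
have := posS j; rewrite !domS hidden //=; last first.
  by rewrite /llt /=; lia.
by rewrite /bar eqxx; lia.
Qed.

Lemma supported_of_yamanouchi : supported T.
Proof.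
move=> k x /onthP[c /on_coord_of_yamanouchi]; rewrite /is_coord /on_coord /=.
by case: x.
Qed.
End Support.

(** * Interlacing sequences *)

(** In row i + k, the letters \overline{i+1} occupy the columns d k, ..., a k - 1
    and the letters \bar i the columns a k, ..., b k - 1. Row i contains a 0
    letters i, and row i + 1 contains e letters i + 1. *)
Section Interlacing.
Variables (a b d : nat -> nat) (e : nat).
Hypotheses (le_da : forall k, d k <= a k) (le_ab : forall k, a k <= b k)
           (le_ba : forall k, b k.+1 <= a k) (le_ad : forall k, a k.+1 <= d k).

(** Reading by rows, up to the letters \bar i of row i + l. *)
Definition row_ineq l :=
  e + \sum_(0 <= k < l) (b k.+1 - a k.+1) <= a 0 + \sum_(0 <= k < l) (a k - d k).

(** Reading, in each row i + k, the columns from c k on: the truncated differences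
    count the columns of a block that are read. *)
Definition region_ineq (c : nat -> nat) l :=
  (e - c 1) + \sum_(0 <= k < l) (b k.+1 - maxn (a k.+1) (c k.+1))
  <= (a 0 - c 0) + \sum_(0 <= k < l) (a k - maxn (d k) (c k)).

Lemma interlacing_anti k l : k <= l -> a l <= a k.
Proof.
elim: l => [|l IHl]; first by rewrite leqn0 => /eqP ->.
rewrite leq_eqVlt => /predU1P[->//|/IHl]; have := le_ad l; have := le_da l; lia.
Qed.

(** The blocks of \bar i below row i occupy disjoint sets of columns between a l
    and a 0. *)
Lemma interlacing_telescope l :
  a l + \sum_(0 <= k < l) (b k.+1 - a k.+1) <= a 0.
Proof.
elim: l => [|l IHl]; first by rewrite big_nil addn0.
by rewrite big_nat_recr //=; have := le_ba l; have := le_ab l.+1; lia.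
Qed.

(** If the region contains no i + 1, the letters i read exceed the letters \bar i
    read by at least the excess of a over c in the last row, because the blocks
    of \bar i do not overlap. Otherwise, as long as c does not cut the blocks of
    \overline{i+1}, all barred letters are read and the row inequality applies;
    from the first row on where it does, each further \bar i read lies
    below a letter \overline{i+1} that has been read. *)
Lemma region_ineq_of_row_ineq c L : d 0 = a 0 -> (forall k, c k <= c k.+1) ->
  (forall l, l <= L -> row_ineq l) -> region_ineq c L.
Proof.
move=> d0 c_mono rowL; rewrite /region_ineq.
have [le_ec|lt_ce] := leqP e (c 1).
  have -> : e - c 1 = 0 by apply/eqP; rewrite subn_eq0.
  suff: (a L - c L) + \sum_(0 <= k < L) (b k.+1 - maxn (a k.+1) (c k.+1))
     <= (a 0 - c 0) + \sum_(0 <= k < L) (a k - maxn (d k) (c k)) by lia.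
  elim: L {rowL} => [|l IHl]; first by rewrite !big_nil.
  rewrite !big_nat_recr //=.
  by have := le_ba l; have := le_ab l.+1; have := c_mono l; lia.
(* S, S' and D, D' are the sides of the region and the row inequality up to row
   l. By the second conjunct, the region inequality is at least as slack as the
   row inequality as long as c has cut none of the blocks of \overline{i+1}. *)
pose S l := (e - c 1) + \sum_(0 <= k < l) (b k.+1 - maxn (a k.+1) (c k.+1)).
pose S' l := (a 0 - c 0) + \sum_(0 <= k < l) (a k - maxn (d k) (c k)).
pose D l := e + \sum_(0 <= k < l) (b k.+1 - a k.+1).
pose D' l := a 0 + \sum_(0 <= k < l) (a k - d k).
suff [] : S L <= S' L /\ (c L <= d L -> S L + D' L <= S' L + D L) by [].
elim: L rowL => [|l IHl] rowL.
  have := rowL 0 isT; rewrite /row_ineq /S /S' /D /D' !big_nil.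
  by have := c_mono 0; lia.
have [IH1 IH2] := IHl (fun k le_kl => rowL k (leqW le_kl)).
have row1 : D l.+1 <= D' l.+1 by exact: rowL.
move: row1 IH1 IH2; rewrite /S /S' /D /D' !big_nat_recr //=.
have := c_mono l; have := le_ba l; have := le_ab l.+1; have := le_ad l.
have := le_da l; have := le_da l.+1.
set s1 := \sum_(0 <= k < l) _; set s2 := \sum_(0 <= k < l) _.
set s3 := \sum_(0 <= k < l) _; set s4 := \sum_(0 <= k < l) _.
lia.
Qed.

Hypothesis le_ea : e <= a 0.

(** This region contains the blocks of \bar i up to row i + l and the blocks of
    \overline{i+1} above that row, and nothing else of either kind. It omits the
    first a l letters i, and as many letters i + 1 if e >= a l, so that the two
    inequalities then coincide; if e < a l, telescoping suffices. *)
Lemma row_ineq_of_region_ineq l L : l <= L ->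
  region_ineq (fun k => a l + (l < k)) L -> row_ineq l.
Proof.
move=> le_lL; case: l le_lL => [|l] le_lL; first by rewrite /row_ineq !big_nil !addn0.
rewrite /region_ineq /row_ineq.
rewrite [a l.+1 + (l.+1 < 1)]addn0 => reg.
have tele := interlacing_telescope l.+1.
have := reg.
rewrite (big_cat_nat (n := l.+1) (p := L)) //=.
rewrite [in X in _ <= X](big_cat_nat (n := l.+1) (p := L)) //=.
rewrite [X in _ <= _ + (_ + X)]big_nat_cond [X in _ <= _ + (_ + X)]big1; last first.
  by move=> k /andP[/andP[le_lk _] _]; have := interlacing_anti le_lk; lia.
rewrite (@eq_big_nat _ _ _ 0 l.+1 _ (fun k => b k.+1 - a k.+1)); last first.
  move=> k /andP[_ lt_kl]; have := @interlacing_anti k.+1 l.+1 lt_kl; lia.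
rewrite (@eq_big_nat _ _ _ 0 l.+1 (fun k => a k - maxn (d k) _) (fun k => a k - d k)); last first.
  move=> k /andP[_ lt_kl]; have := @interlacing_anti k.+1 l.+1 lt_kl.
  by have := le_ad k; lia.
lia.
Qed.
End Interlacing.

(** * Highest weight tableaux and the dominance inequalities *)

Lemma sum_nat_shift (F : nat -> nat) m l :
  \sum_(m <= k < l + m) F k = \sum_(0 <= k < l) F (k + m).
Proof. by rewrite -{1}[m]add0n big_addn addnK. Qed.

Section Dominance.
Variables (n : nat) (T : filling n).
Hypothesis sst : young_tableau T.
Let size_T : size T = n. Proof. by case: sst. Qed.
Let part : sorted geq (shape T). Proof. by case: sst. Qed.
Let rows t : t \in T -> sorted (@lle n) t. Proof. by case: sst => _ _ + _; apply. Qed.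
Let cols k x : count (@lle n ^~ x) (nth [::] T k.+1) <= count (@llt n ^~ x) (nth [::] T k).
Proof. by case: sst. Qed.
Hypothesis supp : supported T.

Local Notation row := (nth [::] T).

Lemma supported_row k x : x \in row k -> on_coord x k.
Proof.
have [lt_k|le_k] := ltnP k n; last by rewrite nth_default ?size_T.
by move=> /(supp (k := Ordinal lt_k)); case: x.
Qed.

Lemma unb_row (i : 'I_n) (k : nat) : k != i -> count_mem (unb i) (row k) = 0.
Proof.
move=> ne_ki; apply/count_memPn/negP => /supported_row /eqP e.
by rewrite e eqxx in ne_ki.
Qed.

Lemma bar_row (i : 'I_n) (k : nat) : k <= i -> count_mem (bar i) (row k) = 0.
Proof.
by move=> le_ki; apply/count_memPn/negP => /supported_row /=; rewrite ltnNge le_ki.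
Qed.

Lemma count_llt_unb (i : 'I_n) : count (@llt n ^~ (unb i)) (row i) = 0.
Proof.
apply/eqP; rewrite -leqn0 leqNgt -has_count; apply/negP => /hasP[x /supported_row].
case: x => j /=; first by move=> /eqP e; rewrite /llt /= e ltnn.
by rewrite /llt /=; have := ltn_ord i; lia.
Qed.

Lemma count_region_rows x c r l m : l <= m -> n <= m ->
  (forall k, k < l -> count_mem x (row k) = 0) ->
  count_mem x (region T c r) =
  \sum_(l <= k < m) count_mem x (drop (c + (r <= k)) (row k)).
Proof.
move=> le_lm le_nm x0.
have zero k : count_mem x (row k) = 0 -> count_mem x (drop (c + (r <= k)) (row k)) = 0.
  move=> e; apply/eqP; rewrite -leqn0 -e.
  rewrite -[X in _ <= count _ X](cat_take_drop (c + (r <= k))).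
  by rewrite count_cat leq_addl.
rewrite count_region size_T.
rewrite -(big_mkord xpredT (fun k => count_mem x (drop (c + (r <= k)) (nth [::] T k)))).
transitivity (\sum_(0 <= k < m) count_mem x (drop (c + (r <= k)) (row k))).
  rewrite [RHS](big_cat_nat (leq0n n) le_nm) //=.
  rewrite [X in _ + X]big_nat_cond [X in _ + X]big1 ?addn0 //.
  move=> k /andP[/andP[le_nk _] _]; apply: zero.
  by rewrite nth_default ?size_T.
rewrite (big_cat_nat (leq0n l) le_lm) //= big_nat_cond big1 ?add0n //.
by move=> k /andP[/andP[_ lt_kl] _]; apply: zero; apply: x0.
Qed.

Lemma count_unb_region (i : 'I_n) c r :
  count_mem (unb i) (region T c r) = count_mem (unb i) (row i) - (c + (r <= i)).
Proof.
have e := count_mem_letter (row i) (unb i); rewrite count_llt_unb addn0 in e.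
rewrite (@count_region_rows _ c r i n (ltnW (ltn_ord i)) (leqnn n)); last first.
  by move=> k lt_ki; rewrite unb_row ?ltn_eqF.
rewrite (big_cat_nat (n := i.+1)) //= big_nat1.
rewrite [X in _ + X]big_nat_cond [X in _ + X]big1; last first.
  move=> k /andP[/andP[lt_ik _] _]; apply/count_memPn/negP => /mem_drop ki.
  have ne_ki : k != i by rewrite gtn_eqF.
  by have /count_memPn := unb_row ne_ki; rewrite ki.
rewrite addn0 count_mem_drop; last exact: sorted_row.
by rewrite count_llt_unb max0n e.
Qed.

Section ConsecutiveLetters.
Variables i i' : 'I_n.
Hypothesis ei' : i' = i.+1 :> nat.

(** The sequences b, a, d of the blocks of \bar i and \bar i' in row i + k. *)
Definition block_end_bar k := count (@lle n ^~ (bar i)) (row (k + i)).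
Definition block_end_bar' k := count (@lle n ^~ (bar i')) (row (k + i)).
Definition block_start_bar' k := count (@llt n ^~ (bar i')) (row (k + i)).
Local Notation b := block_end_bar.
Local Notation a := block_end_bar'.
Local Notation d := block_start_bar'.
Local Notation e := (count_mem (unb i') (row i')).

(** No letter lies strictly between \bar i' and \bar i. *)
Lemma block_start_bar k : count (@llt n ^~ (bar i)) (row (k + i)) = a k.
Proof.
apply: eq_count => x /=; rewrite /llt /lle /= ei'.
by have := ltn_ord i'; lia.
Qed.

Lemma blocks_da k : d k <= a k.
Proof. by apply: sub_count => x /=; apply: ltnW. Qed.

Lemma blocks_ab k : a k <= b k.
Proof. by rewrite -block_start_bar; apply: sub_count => x /=; apply: ltnW. Qed.

Lemma blocks_ba k : b k.+1 <= a k.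
Proof. by rewrite -block_start_bar; apply: cols. Qed.

Lemma blocks_ad k : a k.+1 <= d k.
Proof. exact: cols. Qed.

(** Row i contains no \bar i', as k < i for all its letters \bar k. *)
Lemma blocks_d0 : d 0 = a 0.
Proof.
by rewrite /block_end_bar' -count_mem_letter bar_row // ei'.
Qed.

(** All letters \bar k of row i have k < i, so they are larger than \bar i. *)
Lemma blocks_a0 : a 0 = count_mem (unb i) (row i).
Proof.
apply: eq_in_count => x /supported_row.
case: x => j /=.
  by move=> /eqP /val_inj ->; rewrite eqxx /lle /=; have := ltn_ord i; lia.
move=> lt_ji; have -> : (inr j == unb i :> letter n) = false by [].
by rewrite /lle /=; have := ltn_ord i'; lia.
Qed.

Lemma blocks_ea : e <= a 0.
Proof.
have := count_mem_letter (row i') (unb i'); rewrite count_llt_unb addn0 => ->.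
rewrite ei'; apply: leq_trans (cols _ _) _; apply: sub_count => x /=.
by rewrite /llt /lle /=; have := ltn_ord i'; lia.
Qed.

Lemma sum_bar_blocks l :
  \sum_(i.+1 <= k < l + i.+1) count_mem (bar i) (row k) =
  \sum_(0 <= k < l) (b k.+1 - a k.+1).
Proof.
rewrite sum_nat_shift; apply: eq_bigr => k _.
have H : count_mem (bar i) (row (k.+1 + i)) + a k.+1 = b k.+1.
  by rewrite -block_start_bar; apply: count_mem_letter.
by rewrite -H addnK addSnnS.
Qed.

Lemma sum_bar'_blocks l :
  \sum_(i <= k < l + i) count_mem (bar i') (row k) = \sum_(0 <= k < l) (a k - d k).
Proof.
rewrite sum_nat_shift; apply: eq_bigr => k _.
by rewrite /block_end_bar' -count_mem_letter addnK.
Qed.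

Lemma region_ineqP c r :
  (count_mem (unb i') (region T c r) + count_mem (bar i) (region T c r) <=
   count_mem (unb i) (region T c r) + count_mem (bar i') (region T c r)) =
  region_ineq a b d e (fun k => c + (r <= k + i)) (n - i).
Proof.
rewrite !count_unb_region /region_ineq add0n add1n -ei' -blocks_a0.
rewrite (@count_region_rows (bar i) c r i.+1 (n - i + i.+1)) ?leq_addl //; [|lia|]; last first.
  by move=> k lt_ki; rewrite bar_row.
rewrite (@count_region_rows (bar i') c r i (n - i + i)) ?leq_addl //; [|lia|]; last first.
  by move=> k lt_ki; rewrite bar_row // ei' ltnW // ltnS ltnW.
rewrite !sum_nat_shift.
congr (_ + _ <= _ + _); apply: eq_bigr => k _; rewrite count_mem_drop ?sorted_row //.
by rewrite -addSnnS -block_start_bar.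
Qed.

Lemma row_ineqP (l : nat) : i <= l ->
  (e + \sum_(i.+1 <= k < l.+1) count_mem (bar i) (row k) <=
   count_mem (unb i) (row i) + \sum_(i <= k < l) count_mem (bar i') (row k)) =
  row_ineq a b d e (l - i).
Proof.
move=> le_il; rewrite /row_ineq -sum_bar_blocks -sum_bar'_blocks blocks_a0.
by rewrite addnS subnK.
Qed.
End ConsecutiveLetters.

(** The dominance inequalities in terms of letter counts, with the terms omitted
    that vanish by the support condition, and the summation over the row above
    shifted by one. *)
Definition dominance_ineqs : Prop := forall i i' l : 'I_n, i' = i.+1 :> nat -> i <= l ->
  count_mem (unb i') (row i') + \sum_(i.+1 <= k < l.+1) count_mem (bar i) (row k) <=
  count_mem (unb i) (row i) + \sum_(i <= k < l) count_mem (bar i') (row k).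

(** Each pair of consecutive components is treated by the estimates on its
    interlacing blocks; component n is nonnegative since \bar n does not occur. *)
Lemma yamanouchi_dominance_ineqs : yamanouchi T <-> dominance_ineqs.
Proof.
split=> [yam i i' l ei' le_il|dom c r].
  rewrite row_ineqP //; set m := l - i.
  have [mono _] := (dominantP _).1 (yam (block_end_bar' i i' m) (m + i).+1).
  have /= := mono i i' ltac:(lia); rewrite region_ineqP //.
  rewrite (_ : (fun k => _) = (fun k => block_end_bar' i i' m + (m < k))); last first.
    by apply: funext => k; rewrite ltn_add2r.
  apply: row_ineq_of_region_ineq.
  - exact: blocks_da.
  - exact: blocks_ab.
  - exact: blocks_ba.
  - exact: blocks_ad.
  - exact: blocks_ea.
  - by rewrite leq_sub2r // ltnW.
apply: dominant_consecutive => [i i' ei'|i last].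
  rewrite region_ineqP //; apply: region_ineq_of_row_ineq.
  - exact: blocks_da.
  - exact: blocks_ab.
  - exact: blocks_ba.
  - exact: blocks_ad.
  - exact: blocks_d0.
  - by move=> k; rewrite leq_add2l; case: leqP => //; case: leqP => //; lia.
  have ineq l : l < n - i -> row_ineq (block_end_bar' i i') (block_end_bar i)
      (block_start_bar' i i') (count_mem (unb i') (row i')) l.
    move=> lt_l; have lt_ln : l + i < n by lia.
    have := dom i i' (Ordinal lt_ln) ei' (leq_addl _ _).
    by rewrite row_ineqP ?leq_addl // addnK.
  move=> l; rewrite leq_eqVlt => /predU1P[->|]; last exact: ineq.
  (* For l = n - i the new row is empty, which gives a weaker inequality. *)
  have -> : n - i = (n - i).-1.+1 by have := ltn_ord i; lia.
  have := ineq (n - i).-1 ltac:(have := ltn_ord i; lia).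
  rewrite /row_ineq !big_nat_recr //= [block_end_bar _ _](_ : _ = 0); first by lia.
  by rewrite /block_end_bar nth_default // size_T; have := ltn_ord i; lia.
rewrite (@count_region_rows (bar i) c r n n) ?big_geq // => k lt_kn.
by rewrite bar_row // -ltnS last.
Qed.
End Dominance.

(** * The encoding of a supported tableau *)

Lemma sum_count_mem_pred (A : finType) (P : pred A) (s : seq A) :
  \sum_(a | P a) count_mem a s = count P s.
Proof.
elim: s => [|x s IHs] /=; first by rewrite big1.
rewrite big_split /= IHs; congr (_ + _).
rewrite -big_mkcondr /= (eq_bigl (fun a => (a == x) && P x)); last first.
  by move=> a; rewrite andbC eq_sym; case: eqVneq => // ->.
case: (P x); last by rewrite big1 // => a; rewrite andbF.
by rewrite (eq_bigl (pred1 x)) ?big_pred1_eq // => a; rewrite andbT.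
Qed.

Lemma sum_ord_above (F : nat -> nat) n i :
  \sum_(k < n | i < k) F k = \sum_(i.+1 <= k < n) F k.
Proof. by rewrite big_geq_mkord. Qed.

Lemma sum_ord_range (F : nat -> nat) n i (l : 'I_n) :
  \sum_(k < n | i <= k <= l) F k = \sum_(i <= k < l.+1) F k.
Proof.
rewrite (big_nat_widen _ _ n) ?ltn_ord // big_geq_mkord.
by apply: eq_bigl => k; rewrite /= ltnS andbC.
Qed.

Section Encoding.
Variables (R : realType) (n : nat) (T : filling n).
Hypothesis supp : supported T.

Local Notation row := (nth [::] T).
Let x := wvec R T.

Lemma cell_wvec c (k : 'I_n) : cell x c k = ((count_mem c (row k))%:R)%R.
Proof.
rewrite /cell; case: insubP => [u _ e|not_coord] /=.
  by rewrite ffunE /mult; move: e => /= ->.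
rewrite (count_memPn _) //; apply: contra not_coord; exact: supp.
Qed.

Lemma sum_cell_wvec P (k : 'I_n) :
  (\sum_(a | P a) cell x a k = (count P (row k))%:R)%R.
Proof.
rewrite -sum_count_mem_pred natr_sum; apply: eq_bigr => a _; exact: cell_wvec.
Qed.

Lemma shape_cond_wvec (lam : n.-tuple nat) : size T = n ->
  shape_cond lam x <-> shape T = lam.
Proof.
move=> size_T.
have sizeE (j : 'I_n) : (\sum_(c : letter n) cell x c j = (nth 0 (shape T) j)%:R)%R.
  by rewrite (sum_cell_wvec predT) count_predT (nth_map [::]) // size_T.
split=> [H|e j]; last by rewrite sizeE e (tnth_nth 0).
apply: (@eq_from_nth _ 0); first by rewrite size_map size_tuple.
move=> j; rewrite size_map size_T => lt_j.
have := H (Ordinal lt_j); rewrite sizeE (tnth_nth 0) => /eqP.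
by rewrite eqr_nat => /eqP.
Qed.

Lemma semistandard_cond_wvec : size T = n -> semistandard_cond x <->
  forall k c, count (@lle n ^~ c) (row k.+1) <= count (@llt n ^~ c) (row k).
Proof.
move=> size_T; split=> [H k c|H c j j' ej]; last by rewrite !sum_cell_wvec ler_nat ej.
have [lt_k|le_k] := ltnP k.+1 n; last by rewrite nth_default ?size_T.
by have := H c (Ordinal (ltnW lt_k)) (Ordinal lt_k) erefl; rewrite !sum_cell_wvec ler_nat.
Qed.

Hypothesis sst : young_tableau T.
Let size_T : size T = n. Proof. by case: sst. Qed.
Let part : sorted geq (shape T). Proof. by case: sst. Qed.

Lemma cell_above_wvec c (k : 'I_n) :
  cell_above x c k = ((if val k is k'.+1 then count_mem c (row k') else 0)%:R)%R.
Proof.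
rewrite /cell_above; case: k => -[|k] lt_k /=; first by rewrite big1.
have lt_k' : k < n by apply: ltnW.
by rewrite (big_pred1 (Ordinal lt_k')) ?cell_wvec.
Qed.

Lemma weight_cond_wvec (mu : n.-tuple nat) : weight_cond mu x <->
  forall i : 'I_n, count_mem (unb i) (row i) =
    tnth mu i + \sum_(i.+1 <= k < n) count_mem (bar i) (row k).
Proof.
have sumE (i : 'I_n) : (\sum_(k < n | (i < k)%N) cell x (bar i) k =
    (\sum_(i.+1 <= k < n) count_mem (bar i) (row k))%N%:R)%R.
  rewrite -sum_ord_above natr_sum; apply: eq_bigr => k _; exact: cell_wvec.
split=> H i; have := H i; rewrite ?sumE ?cell_wvec.
  by move=> /eqP; rewrite subr_eq -natrD eqr_nat => /eqP.
by move=> ->; rewrite natrD addrK.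
Qed.

Lemma count_word p : count p (word T) = count p (region T 0 n).
Proof.
rewrite /word count_columns; last first.
  by move=> t; rewrite add0n; apply: size_row_head.
rewrite (big_nth [::]) big_mkord count_region; apply: eq_bigr => k _.
have lt_kn : k < n by have := ltn_ord k; rewrite [X in _ < X]size_T.
by rewrite leqNgt lt_kn.
Qed.

Lemma weight_wordP (mu : n.-tuple nat) :
  weight (word T) = (\row_i (tnth mu i)%:Z)%R <-> weight_cond mu x.
Proof.
have wordE (i : 'I_n) : (weight (word T) 0 i = (count_mem (unb i) (row i))%:Z -
    (\sum_(i.+1 <= k < n) count_mem (bar i) (row k))%N%:Z)%R.
  rewrite weightE !count_word (count_unb_region sst supp) leqNgt ltn_ord subn0.
  rewrite (@count_region_rows _ _ sst (bar i) 0 n i.+1 n) // => [|k lt_k].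
    congr (_ - (Posz _))%R; apply: eq_big_nat => k /andP[_ lt_kn].
    by rewrite leqNgt lt_kn drop0.
  by rewrite (bar_row sst supp).
rewrite weight_cond_wvec; split=> [e i|H].
  by have := wordE i; rewrite e mxE; lia.
by apply/rowP => i; rewrite wordE mxE H; lia.
Qed.

Lemma dominance_cond_wvec : dominance_cond x <-> dominance_ineqs T.
Proof.
have sumE (i i' l : 'I_n) : i' = i.+1 :> nat -> i <= l ->
  (\sum_(k < n | (i <= k <= l)%N) (cell x (bar i) k - cell_above x (bar i') k) =
   (\sum_(i.+1 <= k < l.+1) count_mem (bar i) (row k))%N%:R -
   (\sum_(i <= k < l) count_mem (bar i') (row k))%N%:R)%R.
  move=> ei' le_il; rewrite sumrB; congr (_ - _)%R.
    rewrite (eq_bigr _ (fun k _ => cell_wvec (bar i) k)) -natr_sum.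
    rewrite (sum_ord_range (fun k => count_mem (bar i) (row k))) big_ltn //.
    by rewrite (bar_row sst supp).
  rewrite (eq_bigr _ (fun k _ => cell_above_wvec (bar i') k)) -natr_sum.
  pose G k := if k is k'.+1 then count_mem (bar i') (row k') else 0.
  rewrite (sum_ord_range G) big_ltn // /G -/(G i) big_add1 /=.
  have -> : G i = 0.
    rewrite /G; case: (val i) ei' => // k ek; rewrite (bar_row sst supp) // ek.
    exact: leqW.
  by rewrite add0n.
have natE (A E X Y : nat) :
    (0 <= A%:R - E%:R - (X%:R - Y%:R) :> R)%R = (E + X <= A + Y)%N.
  by rewrite opprB addrACA -opprD subr_ge0 -!natrD ler_nat.
by split=> H i i' l ei' le_il; have := H i i' l ei' le_il;
  rewrite sumE // !cell_wvec natE.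
Qed.

(** By interlacing, the last \bar i of any row lies to the left of the end a 0 of
    the letters i in row i. *)
Lemma cancellation_cond_wvec : cancellation_cond x.
Proof.
move=> i k lt_ik; rewrite sum_cell_wvec !cell_wvec -natrD ler_nat count_mem_letter.
have lt_i' : i.+1 < n by apply: leq_ltn_trans lt_ik _.
pose i' := Ordinal lt_i'; have ei' : i' = i.+1 :> nat by [].
have := interlacing_anti (blocks_da T i i')
  (blocks_ad sst i i') (leq0n (k - i.+1)).
rewrite (blocks_a0 sst supp ei'); apply: leq_trans.
apply: leq_trans (blocks_ba sst ei' _).
by rewrite /block_end_bar addSnnS subnK.
Qed.

Lemma DR_wvecP (lam mu : n.-tuple nat) :
  DR R lam mu x <->
  [/\ shape T = lam, weight (word T) = (\row_i (tnth mu i)%:Z)%R & yamanouchi T].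
Proof.
have yamP := yamanouchi_dominance_ineqs sst supp.
split.
  by move=> [[_ /(shape_cond_wvec _ size_T) ? /weight_wordP ?]
             [_ _ /dominance_cond_wvec/yamP ?]].
move=> [/(shape_cond_wvec _ size_T) ? /weight_wordP ? /yamP/dominance_cond_wvec ?].
split; split=> //; last exact: cancellation_cond_wvec.
- by move=> p; rewrite ffunE ler0n.
- by apply/(semistandard_cond_wvec size_T); case: sst.
Qed.
End Encoding.

(** * The bijection *)

Section Bijection.
Variables (R : realType) (n : nat) (lam mu : n.-tuple nat).
Hypothesis lam_part : is_partition lam.

Lemma domresP (T : filling n) : domres lam mu T <->
  [/\ young_tableau T, shape T = lam,
      weight (word T) = (\row_i (tnth mu i)%:Z)%R & yamanouchi T].
Proof.
split=> [[shT sstT wT domT]|[[_ partT rowsT colsT] shT wT yamT]].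
  have partT : sorted geq (shape T) by rewrite shT.
  have [rowsT colsT] := (semistandardP partT).1 sstT.
  split=> //; last exact/(yamanouchiP partT).
  by split=> //; rewrite -(size_map size) -/(shape T) shT size_tuple.
by split=> //; [apply/(semistandardP partT)|apply/(yamanouchiP partT)].
Qed.

Lemma domres_supported (T : filling n) : domres lam mu T -> supported T.
Proof.
by move=> /domresP[sstT _ _ yamT]; apply: supported_of_yamanouchi.
Qed.

Lemma wvec_lattice_point (T : filling n) :
  domres lam mu T -> lattice_points (DR R lam mu) (wvec R T).
Proof.
move=> domT; have suppT := domres_supported domT.
have [sstT shT wT yamT] := (domresP T).1 domT; split; first exact/DR_wvecP.
by move=> p; rewrite ffunE natr_int.
Qed.

(** A sorted row is determined by its letter counts. *)
Lemma wvec_inj (T T' : filling n) : domres lam mu T -> domres lam mu T' ->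
  wvec R T = wvec R T' -> T = T'.
Proof.
move=> domT domT' eT.
have suppT := domres_supported domT; have suppT' := domres_supported domT'.
have [[sT _ rowsT _] _ _ _] := (domresP T).1 domT.
have [[sT' _ rowsT' _] _ _ _] := (domresP T').1 domT'.
apply: (@eq_from_nth _ [::]); first by rewrite sT sT'.
move=> k lt_k; rewrite sT in lt_k.
apply: (sorted_eq (@lle_trans n) (@lle_anti n)).
- by apply: rowsT; rewrite mem_nth ?sT.
- by apply: rowsT'; rewrite mem_nth ?sT'.
apply/allP => c _; apply/eqP; have := cell_wvec R suppT c (Ordinal lt_k).
by rewrite eT cell_wvec // => /eqP; rewrite eqr_nat => /eqP.
Qed.

(** The coordinates of a lattice point are natural numbers, so truncation keeps
    them. *)
Definition tableau_of (x : {ffun Defs.coord n -> R}) : filling n :=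
  [seq sort (@lle n)
     (flatten [seq nseq (Num.truncn (cell x c j)) c | c <- enum (letter n)])
  | j <- enum 'I_n].

Lemma size_tableau_of x : size (tableau_of x) = n.
Proof. by rewrite size_map size_enum_ord. Qed.

Lemma count_tableau_of x c (j : 'I_n) :
  count_mem c (nth [::] (tableau_of x) j) = Num.truncn (cell x c j).
Proof.
rewrite (nth_map j) ?size_enum_ord // nth_ord_enum.
rewrite (permP (permEl (perm_sort _ _))) count_flatten sumnE 2!big_map big_enum /=.
rewrite (bigD1 c) //= count_nseq /= eqxx mul1n big1 ?addn0 // => a ne_ac.
by rewrite count_nseq /= (negPf ne_ac).
Qed.

Lemma rows_tableau_of x t : t \in tableau_of x -> sorted (@lle n) t.
Proof. by move=> /mapP[j _ ->]; apply/sort_sorted/lle_total. Qed.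

Lemma supported_tableau_of x : supported (tableau_of x).
Proof.
move=> j c; rewrite -has_pred1 has_count count_tableau_of /cell.
by case: insubP => //= _; rewrite truncn0.
Qed.

Lemma wvec_tableau_of (x : {ffun Defs.coord n -> R}) :
  (forall p, 0 <= x p)%R -> (forall p, x p \is a Num.int) ->
  wvec R (tableau_of x) = x.
Proof.
move=> x_ge0 x_int; apply/ffunP => p; rewrite ffunE /mult count_tableau_of /cell.
have -> : insub ((sval p).1, (sval p).2) = Some p.
  by rewrite -surjective_pairing; apply: valK.
by rewrite /= truncnK // natrEint x_int x_ge0.
Qed.

Lemma wvec_bij :
  set_bij (domres lam mu) (lattice_points (DR R lam mu)) (wvec R).
Proof.
split.
- exact: wvec_lattice_point.
- by move=> T T' /set_mem ? /set_mem ?; apply: wvec_inj.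
move=> x [DRx x_int]; have [[x_ge0 shx _] [sstx _ _]] := DRx.
have ex := wvec_tableau_of x_ge0 x_int.
have suppT := @supported_tableau_of x.
have sizeT := size_tableau_of x.
rewrite -ex in DRx shx sstx.
have shT := (shape_cond_wvec R suppT lam sizeT).1 shx.
have sstT : young_tableau (tableau_of x).
  split=> //; first by rewrite shT.
    exact: rows_tableau_of.
  exact: (semistandard_cond_wvec R suppT sizeT).1.
exists (tableau_of x) => //; apply/domresP.
by have [] := (DR_wvecP R suppT sstT lam mu).1 DRx.
Qed.
End Bijection.

Theorem theorem57 (R : realType) (n : nat) (lam mu : n.-tuple nat)
    (n_ge1 : (1 <= n)%N) (lam_part : is_partition lam)
    (mu_part : is_partition mu) (mu_lam : included mu lam) :
  is_polytope (DR R lam mu) /\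
  set_bij (domres lam mu) (lattice_points (DR R lam mu)) (wvec R).
Proof. by split; [apply: polytope_DR|apply: wvec_bij]. Qed.
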